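(* Let $r\ge1$, let $b_1\ge\cdots\ge b_r$ be integers with $b_i\ge i$ for all $i$, let $M=b_1-1$, and let $u_1,\dots,u_M$ be commuting indeterminates. For $0\le j\le M$, $(i,c)\in F_{\mathbf b}$ and $\sigma\in\{\varnothing,L,R\}$ (recording the previous move), define polynomials $G_j(i,c;\sigma)$ recursively: $G_0(i,i;\varnothing)=1$ for $1\le i\le r$ and all other values $G_0(\cdot)$ are $0$; and for $1\le j\le M$ the polynomials $G_j$ start at $0$ and are accumulated through the following transitions, over all $(i,c)\in F_{\mathbf b}$ and all $\sigma\in\{\varnothing,L,R\}$: - if $(i-1,c)\in F_{\mathbf b}$, add $G_{j-1}(i,c;\sigma)\cdot u_j^{\epsilon(\sigma)}$ to $G_j(i-1,c;L)$, where $\epsilon(\sigma)=1$ if $\sigma\in\{\varnothing,R\}$ and $\epsilon(\sigma)=0$ if $\sigma=L$; - if $(i,c+1)\in F_{\mathbf b}$, add $G_{j-1}(i,c;\sigma)$ to $G_j(i,c+1;R)$. Then $$\mathcal D_{\mathbf b}(\mathbf u)=\sum_{\sigma\in\{\varnothing,L,R\}}G_M(1,b_1;\sigma).$$ In particular, the complete multivariate enumerator $\mathcal D_{\mathbf b}(\mathbf u)$, and hence the $q$-Zeta numerator $\mathbb{H}_{F_{\mathbf b},\rho}(q,t)=\mathcal D_{\mathbf b}(t,tq,\dots,tq^{M-1})$, is computable with $O(M\,|F_{\mathbf b}|)$ polynomial-ring transitions.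
   Context: Ferrers-cell poset: $F_{\mathbf b}=\{(i,c):1\le i\le r,\ i\le c\le b_i\}$, ordered by $(i,c)\le(j,d)\iff i\ge j$ and $c\le d$, with rank $\rho(i,c)=c-i$. Words: for $w\in\{L,R\}^M$ let $\ell(w)$ be its number of $L$'s and $\iota(w)=\ell(w)+1$. $\mathcal W_{\mathbf b}$ is the set of $w\in\{L,R\}^M$ with $\ell(w)\le r-1$ such that for every prefix, with $L_k$ letters $L$ and $R_k$ letters $R$, $\iota(w)+R_k\le b_{\iota(w)-L_k}$. $D(w)=\{j: w_j=L\text{ and }(j=1\text{ or }w_{j-1}=R)\}$. The multivariate descent enumerator is $\mathcal D_{\mathbf b}(\mathbf u)=\sum_{w\in\mathcal W_{\mathbf b}}\prod_{j\in D(w)}u_j$. $q$-Zeta numerator: for a finite graded poset $P$ with unique maximum and rank function $\rho:P\to\{0,\dots,H\}$ ($H$ the maximal rank), put $A_m(P,\rho;q)=\sum_{x_1\le\cdots\le x_m}q^{\rho(x_1)+\cdots+\rho(x_m)}$ ($A_0=1$); $\mathbb{H}_{P,\rho}(q,t)$ is determined by $\sum_{m\ge 0}A_m(P,\rho;q)t^m=\mathbb{H}_{P,\rho}(q,t)/\prod_{a=0}^{H}(1-q^at)$. A ''polynomial-ring transition'' is one update step of the form displayed in the two bullet points. *)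

(* Defs.v *)
From HB Require Import structures.
From mathcomp Require Import all_boot all_order all_algebra.
From mathcomp.multinomials Require Export mpoly.

Set Implicit Arguments.
Unset Strict Implicit.
Unset Printing Implicit Defensive.

Import Order.TTheory GRing.Theory.
Local Open Scope ring_scope.

(* All indices are 1-based: b_i is [b i], and only the values with
   1 <= i <= r matter. *)
Definition ferrers_shape (r : nat) (b : nat -> nat) : Prop :=
  [/\ (0 < r)%N,
      forall i, (1 <= i < r)%N -> (b i.+1 <= b i)%N
    & forall i, (1 <= i <= r)%N -> (i <= b i)%N].

Definition wlen (b : nat -> nat) : nat := (b 1%N).-1.

Definition in_ferrers (r : nat) (b : nat -> nat) (x : nat * nat) : bool :=
  (1 <= x.1 <= r)%N && (x.1 <= x.2 <= b x.1)%N.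

Definition ferrers_cells (r : nat) (b : nat -> nat) : seq (nat * nat) :=
  [seq (i, c) | i <- iota 1 r, c <- iota i ((b i).+1 - i)].

Lemma mem_ferrers_cells r b x :
  (x \in ferrers_cells r b) = in_ferrers r b x.
Proof.
case: x => i c; rewrite /in_ferrers /=.
apply/allpairsPdep/idP => [[i' [c' [+ + [-> ->]]]]|/andP[ir /andP[ic cb]]].
  rewrite !mem_iota add1n ltnS => -> /andP[ic].
  case: (leqP i' (b i').+1) => [le_ib|/ltnW]; first by rewrite subnKC // ltnS ic.
  by rewrite -subn_eq0 => /eqP->; rewrite addn0 ltnNge ic.
exists i, c; split=> //; rewrite mem_iota ?add1n ?ltnS // ic.
by rewrite subnKC ?ltnS // leqW // (leq_trans ic).
Qed.

Definition ferrers (r : nat) (b : nat -> nat) : Type :=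
  seq_sub (ferrers_cells r b).

HB.instance Definition _ r b := Finite.on (ferrers r b).
HB.instance Definition _ r b :=
  SubType.copy (ferrers r b) (seq_sub (ferrers_cells r b)).

Section FerrersOrder.
Variables (r : nat) (b : nat -> nat).

Definition ferrers_le (x y : ferrers r b) : bool :=
  ((val y).1 <= (val x).1)%N && ((val x).2 <= (val y).2)%N.

Fact ferrers_le_refl : reflexive ferrers_le.
Proof. by move=> x; rewrite /ferrers_le !leqnn. Qed.

Fact ferrers_le_anti : antisymmetric ferrers_le.
Proof.
move=> x y /andP[/andP[a1 a2] /andP[a3 a4]]; apply: val_inj.
apply/eqP; rewrite -pair_eqE /pair_eq /=.
by rewrite !eqn_leq a1 a2 a3 a4.
Qed.

Fact ferrers_le_trans : transitive ferrers_le.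
Proof.
move=> y x z /andP[a1 a2] /andP[a3 a4].
by rewrite /ferrers_le (leq_trans a3 a1) (leq_trans a2 a4).
Qed.

Fact ferrers_display : Order.disp_t. Proof. exact: Order.Disp tt tt. Qed.

HB.instance Definition _ := Order.Le_isPOrder.Build ferrers_display
  (ferrers r b) ferrers_le_refl ferrers_le_anti ferrers_le_trans.

Definition ferrers_rank (x : ferrers r b) : nat := ((val x).2 - (val x).1)%N.

End FerrersOrder.

(* Z[q] is [{poly int}] and Z[q][t] is [{poly {poly int}}]. *)
Section QZeta.
Variables (d : Order.disp_t) (P : finPOrderType d) (rho : P -> nat).

Definition multichain_enum (m : nat) : {poly int} :=
  \sum_(x : m.-tuple P | sorted <=%O x) 'X^(\sum_(y <- x) rho y).

Definition max_rank : nat := \max_(x : P) rho x.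

Definition qzeta_den : {poly {poly int}} :=
  \prod_(a < max_rank.+1) (1 - ('X^a)%:P * 'X).

(* sum_m A_m t^m = N / qzeta_den in Z[q][[t]], compared coefficientwise after
   multiplication by the denominator, which is a unit of Z[q][[t]] since its
   constant term is 1. *)
Definition is_qzeta_numerator (N : {poly {poly int}}) : Prop :=
  forall n : nat,
    \sum_(k < n.+1) multichain_enum (n - k) * qzeta_den`_k = N`_n.

End QZeta.

Inductive letter := L | R.

Definition isL (a : letter) : bool := if a is L then true else false.
Definition letter_of (e : bool) : letter := if e then L else R.
Fact isLK : cancel isL letter_of. Proof. by case. Qed.
HB.instance Definition _ := Finite.copy letter (can_type isLK).

Definition nL (w : seq letter) : nat := count_mem L w.
Definition nR (w : seq letter) : nat := count_mem R w.
Definition start_row (w : seq letter) : nat := (nL w).+1.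

Definition in_words (r : nat) (b : nat -> nat) (w : seq letter) : bool :=
  (nL w <= r.-1)%N &&
  all (fun k => start_row w + nR (take k w)
                  <= b (start_row w - nL (take k w)))%N
      (iota 0 (size w).+1).

(* The letter w_j is [nth _ w j.-1]; default letters are never reached. *)
Definition is_descent (w : seq letter) (j : nat) : bool :=
  (nth R w j.-1 == L) && ((j == 1%N) || (nth L w j.-2 == R)).

(* [u j] stands for u_j, 1 <= j <= M. *)
Definition descent_enum (A : comNzRingType) (r : nat) (b : nat -> nat)
    (u : nat -> A) : A :=
  \sum_(w : (wlen b).-tuple letter | in_words r b w)
    \prod_(j <- iota 1 (wlen b) | is_descent w j) u j.

(* The indeterminate u_j, with 1 <= j <= M. The variables of [{mpoly int[M]}]
   are indexed from 0; other values of j are never used. *)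
Definition indet (M : nat) (j : nat) : {mpoly int[M]} :=
  if insub j.-1 is Some k then 'X_k else 0.

Definition tq_weight (j : nat) : {poly {poly int}} := 'X * ('X^(j.-1))%:P.

Definition descent_poly (r : nat) (b : nat -> nat) : {mpoly int[wlen b]} :=
  descent_enum r b (indet (wlen b)).

Definition subst_tq (M : nat) (p : {mpoly int[M]}) : {poly {poly int}} :=
  mmap intr (fun k : 'I_M => tq_weight k.+1) p.

(* The previous move sigma is an [option letter], [None] being the empty
   one. A table gives a value to each (j, (i, c), sigma). *)
Definition table (A : Type) : Type := nat -> nat * nat -> option letter -> A.

Definition target (a : letter) (x : nat * nat) : nat * nat :=
  if a is L then (x.1.-1, x.2) else (x.1, x.2.+1).

Definition epsilon (s : option letter) : nat := if s is Some L then 0 else 1.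

Section Recursion.
Variables (A : comNzRingType) (r : nat) (b : nat -> nat) (u : nat -> A).

Definition move_weight (j : nat) (s : option letter) (a : letter) : A :=
  if a is L then u j ^+ epsilon s else 1.

Definition G0 (x : nat * nat) (s : option letter) : A :=
  ((s == None) && (x.1 == x.2) && (1 <= x.1 <= r)%N)%:R.

Fixpoint G (j : nat) (x : nat * nat) (s : option letter) : A :=
  if j is j'.+1 then
    \sum_(y : ferrers r b) \sum_(s' : option letter)
      \sum_(a : letter | in_ferrers r b (target a (val y))
                         && (x == target a (val y)) && (s == Some a))
        G j' (val y) s' * move_weight j s' a
  else G0 x s.

(* A transition is one update of a mutable table: it adds the contribution of
   the entry (j - 1, cell, sigma) along one move to the entry it leads to at
   level j = [tr_level]. *)
Record transition := Transition {
  tr_level : nat;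
  tr_cell : nat * nat;
  tr_prev : option letter;
  tr_move : letter }.

Definition legal_transition (T : transition) : bool :=
  [&& (1 <= tr_level T <= wlen b)%N,
      in_ferrers r b (tr_cell T)
    & in_ferrers r b (target (tr_move T) (tr_cell T))].

Definition exec (g : table A) (T : transition) : table A :=
  fun j x s =>
    if [&& j == tr_level T, x == target (tr_move T) (tr_cell T)
         & s == Some (tr_move T)]
    then g j x s + g j.-1 (tr_cell T) (tr_prev T)
                   * move_weight j (tr_prev T) (tr_move T)
    else g j x s.

Definition init_table : table A :=
  fun j x s => if j == 0%N then G0 x s else 0.

Definition run (prog : seq transition) : table A := foldl exec init_table prog.

Definition output (g : table A) : A :=
  \sum_(s : option letter) g (wlen b) (1%N, b 1%N) s.

End Recursion.

(* Main.v *)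
(* The value G_j(x; s) sums the descent weights of all lattice paths of length j
   inside F_b that start at some (i, i), end at x and have last move s; a word of
   W_b is exactly such a path ending at (1, b_1).

   For the q-Zeta numerator no shelling is needed.  Let Z(i,c) be the series
   enumerating the multichains of cells below (i,c).  Removing the top element and
   inclusion-exclusion over the two lower neighbours give, with k = c - i,
     (1 - q^k t) Z(i,c) = Z(i,c-1) + Z(i+1,c) - Z(i+1,c-1).
   Splitting the paths ending at (i,c) by their last two moves gives, for their
   descent enumerator N,
     N(i,c) = N(i,c-1) + N(i+1,c) - (1 - u_k) N(i+1,c-1).
   (If (i+1,c) is not a cell, only the first term remains in both recurrences.)
   At u_k = t q^(k-1) these are the same recurrence once Z(i,c) is multiplied by
   prod_(a <= k) (1 - q^a t), so Z(1,b_1) has numerator N(1,b_1). *)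
Require Import Defs.
From mathcomp Require Import all_boot all_order all_algebra.
From mathcomp Require Import zify ring.
Import GRing.Theory.
Local Open Scope ring_scope.

Set Implicit Arguments.
Unset Strict Implicit.
Unset Printing Implicit Defensive.

(** Splitting at the last entry serves twice: a path is extended by its final move, a multichain by
    its largest element. *)
Lemma big_tuple_rcons (V : nmodType) (T : finType) (n : nat) (F : seq T -> V) :
  \sum_(w : n.+1.-tuple T) F w
  = \sum_(w : n.-tuple T) \sum_(a : T) F (rcons w a).
Proof.
rewrite pair_big /=.
rewrite (reindex (fun p : n.-tuple T * T => [tuple of rcons p.1 p.2])) //=.
exists (fun w => ([tuple of belast (thead w) (behead w)],
                  last (thead w) (behead w))).
  move=> [w a] _ /=; congr (_, _); last first.
    by rewrite /thead (tnth_nth a) /=; case: w => -[|x s] hs //=; rewrite last_rcons.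
  apply: val_inj => /=; rewrite /thead (tnth_nth a) /=.
  by case: w => -[|x s] hs //=; rewrite belast_rcons.
move=> w _; apply: val_inj; case/tupleP: w => x w /=.
by rewrite theadE -lastI.
Qed.

(** * Words as lattice paths, and the recursion for G *)

Section Words.
Variables (A : comNzRingType) (r : nat) (b : nat -> nat) (u : nat -> A).
Implicit Types (w : seq letter) (i j : nat).

(** Truncated subtraction is harmless: row 0 contains no cell, so [path_in] rejects a path that runs
    past row 1. *)
Definition path_end i w : nat * nat := (i - nL w, i + nR w)%N.

Definition path_in i w : bool :=
  all (fun k => in_ferrers r b (path_end i (take k w))) (iota 0 (size w).+1).

Definition last_move w : option letter := ohead (rev w).

Definition weight w : A :=
  \prod_(j <- iota 1 (size w) | is_descent w j) u j.

Lemma path_end_rcons i w a :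
  path_end i (rcons w a) = target a (path_end i w).
Proof.
rewrite /path_end /nL /nR -cats1 !count_cat /=.
by case: a => /=; congr (_, _); lia.
Qed.

Lemma path_in_rcons i w a :
  path_in i (rcons w a) = path_in i w && in_ferrers r b (path_end i (rcons w a)).
Proof.
rewrite /path_in size_rcons -[(size w).+2]addn1 iotaD all_cat /= andbT add0n.
congr (_ && _); last by rewrite take_oversize // size_rcons.
rewrite !take0; congr (_ && _).
apply: eq_in_all => k; rewrite mem_iota add1n ltnS.
by rewrite -cats1 => /andP[_ /takel_cat->].
Qed.

Lemma path_in_end i w : path_in i w -> in_ferrers r b (path_end i w).
Proof.
move/allP/(_ (size w)); rewrite take_size; apply.
by rewrite mem_iota /= add0n.
Qed.

Lemma last_move_rcons w a : last_move (rcons w a) = Some a.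
Proof. by rewrite /last_move rev_rcons. Qed.

(** Whether j is a descent depends only on letters j-1 and j, so an appended letter affects only its
    own position. *)
Lemma weight_rcons w a :
  weight (rcons w a) = weight w * move_weight u (size w).+1 (last_move w) a.
Proof.
rewrite /weight size_rcons -[in LHS](addn1 (size w)) iotaD big_cat /= add1n.
congr (_ * _).
  rewrite big_seq_cond [RHS]big_seq_cond; apply: eq_bigl => j.
  case: (boolP (j \in _)) => //=; rewrite mem_iota => /andP[j0 jw].
  rewrite /is_descent !nth_rcons.
  by rewrite ifT ?ifT //; lia.
rewrite big_cons big_nil /is_descent /= nth_rcons ltnn eqxx.
(* On the empty word, an appended L is a descent by the clause j = 1, which agrees with
   [epsilon None] being 1. *)
case/lastP: w => [|w c] /=; first by case: a; rewrite ?mulr1 ?expr1.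
rewrite size_rcons /= last_move_rcons nth_rcons size_rcons ltnS leqnn.
rewrite nth_rcons ltnn eqxx.
by case: a c => -[] /=; rewrite /move_weight /= ?mulr1 ?expr1 ?expr0.
Qed.

Hypothesis shape : ferrers_shape r b.

(** Induction on the length, removing the last move. Conditions are kept as 0/1 multiplicities so
    that the sums can be exchanged freely. *)
Lemma G_words j x s :
  G r b u j x s = \sum_(1 <= i < r.+1) \sum_(w : j.-tuple letter)
    (weight w) *+ [&& path_in i w, path_end i w == x & last_move w == s].
Proof.
elim: j x s => [|j IH] x s.
  under eq_bigr => i _.
    rewrite (big_pred1 [tuple]) => [|w]; last by rewrite [w]tuple0 /= eqxx.
    rewrite /weight big_nil /path_in /path_end /= subn0 addn0 andbT; over.
  rewrite /= /G0; case: x => x1 x2 /=.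
  rewrite -[_ && _ && _]andbA [in LHS]eq_sym andbA [in LHS]andbC.
  have [/andP[x1_gt0 x1_le]|x1_out] /= := boolP (1 <= x1 <= r)%N.
    rewrite (bigD1_seq x1) /= ?mem_index_iota ?iota_uniq ?ltnS ?x1_gt0 //.
    rewrite big1_seq => [|i /andP[ix _]]; last first.
      by rewrite xpair_eqE (negPf ix) andbF.
    rewrite addr0 xpair_eqE eqxx /in_ferrers /= x1_gt0 x1_le leqnn.
    have [_ _ ->] := shape; last by rewrite x1_gt0.
    by rewrite andbC.
  rewrite big1_seq // => i /andP[_]; rewrite mem_index_iota ltnS => i_in.
  rewrite xpair_eqE; case: eqP => [eix|_]; last by rewrite andbF.
  by rewrite -eix i_in in x1_out.
under [RHS]eq_bigr => i _.
  rewrite (big_tuple_rcons _ (fun w => weight w *+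
    [&& path_in i w, path_end i w == x & last_move w == s])).
  under eq_bigr => w _.
    under eq_bigr => a _.
      (* For a fixed word, exactly one pair q contributes: its end cell and its last move. This
         creates the sum over cells and previous moves in [G]. *)
      have -> : weight (rcons w a) *+
          [&& path_in i (rcons w a), path_end i (rcons w a) == x
             & last_move (rcons w a) == s] =
        \sum_(q : ferrers r b * option letter)
          (weight w *+ [&& path_in i w, path_end i w == val q.1
                           & last_move w == q.2]
           * move_weight u j.+1 q.2 a) *+
           [&& in_ferrers r b (target a (val q.1)), x == target a (val q.1)
             & s == Some a].
        rewrite path_in_rcons path_end_rcons last_move_rcons weight_rcons size_tuple.
        case: (boolP (path_in i w)) => [w_in|_]; last first.
          by rewrite big1 // => q _; rewrite mul0r mul0rn.
        have end_in : path_end i w \in ferrers_cells r b.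
          by rewrite mem_ferrers_cells path_in_end.
        rewrite (bigD1 (SeqSub end_in, last_move w)) //= !eqxx /=.
        rewrite big1 ?addr0 => [|[y s'] /=].
          by rewrite mulr1n [x == _]eq_sym [s == _]eq_sym andbA.
        rewrite xpair_eqE -val_eqE /= negb_and.
        rewrite [_ == val y]eq_sym [_ == s']eq_sym.
        by case/orP => /negPf ->; rewrite ?andbF mul0r mul0rn.
      over.
    rewrite exchange_big; over.
  rewrite exchange_big; over.
rewrite exchange_big /= pair_bigA /=.
apply: eq_bigr => -[y s'] _ /=.
under [RHS]eq_bigr => i _ do rewrite exchange_big.
rewrite [RHS]exchange_big /= big_mkcond /=; apply: eq_bigr => a _.
rewrite IH -andbA; case: ifP => _; last by rewrite big1 // => i _; rewrite big1.
rewrite mulr_suml; apply: eq_bigr => i _; rewrite mulr_suml.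
by apply: eq_bigr.
Qed.

(** For a path starting at row and column l(w)+1, rows stay between 1 and l(w)+1 and columns never
    drop below l(w)+1. Only the bound by b is a real condition. *)
Lemma in_words_path w :
  size w = wlen b ->
  in_words r b w = (nL w < r)%N && path_in (start_row w) w.
Proof.
move=> szw; have [r_gt0 _ _] := shape.
rewrite /in_words -ltnS prednK //; case: (ltnP (nL w) r) => // wr.
rewrite !andTb /path_in; apply: eq_all => k.
have: (nL (take k w) <= nL w)%N.
  by rewrite -{2}(cat_take_drop k w) /nL count_cat leq_addr.
by rewrite /in_ferrers /path_end /start_row /=; lia.
Qed.

(** A path of length M = b_1 - 1 ends at (1, b_1) exactly when it starts in row l(w)+1, so each word
    is counted for a single start. *)
Lemma descent_enum_G :
  descent_enum r b u = \sum_s G r b u (wlen b) (1%N, b 1%N) s.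
Proof.
have [r_gt0 _ b_ge] := shape.
have b1 : (1 <= b 1)%N by apply: b_ge; rewrite r_gt0.
under eq_bigr => s _ do rewrite G_words.
rewrite exchange_big /=; under eq_bigr => i _ do rewrite exchange_big /=.
rewrite exchange_big /descent_enum big_mkcond /=; apply: eq_bigr => w _.
under [RHS]eq_bigr => i _.
  rewrite (bigD1 (last_move w)) //= eqxx andbT big1 ?addr0 => [|s]; last first.
    by rewrite eq_sym => /negPf ->; rewrite !andbF.
  over.
have szw := size_tuple w.
have nLR : (nL w + nR w = wlen b)%N.
  rewrite -[RHS]szw /nL /nR -(count_predC (pred1 L)); congr addn.
  by apply: eq_count => -[].
rewrite in_words_path // andbC /weight szw.
have end_eq i : path_in i w ->
    (path_end i w == (1%N, b 1%N)) = (i == start_row w).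
  move/path_in_end; rewrite /in_ferrers /path_end /start_row /wlen /=.
  by rewrite xpair_eqE; move: nLR; rewrite /wlen; lia.
have term i : (path_in i w && (path_end i w == (1%N, b 1%N)))
              = path_in (start_row w) w && (i == start_row w).
  case: (boolP (path_in i w)) => [iw|niw] /=.
    by rewrite end_eq //; case: eqP => [<-|]; rewrite ?iw ?andbF.
  by case: eqP => [<-|]; rewrite ?andbF // (negPf niw).
under [RHS]eq_bigr do rewrite term.
case: (path_in (start_row w) w) => /=; last by rewrite big1.
case: (ltnP (nL w) r) => wr.
  rewrite (bigD1_seq (start_row w)) ?mem_index_iota ?iota_uniq //=.
  by rewrite eqxx mulr1n [X in _ + X]big1 ?addr0 // => i /negPf ->.
(* With at least r letters L, the required start row exceeds r and is outside the range of the
   sum. *)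
rewrite big1_seq // => i /andP[_]; rewrite mem_index_iota => /andP[_ ir].
by rewrite ltn_eqF // (leq_trans ir).
Qed.

End Words.

Lemma big_option_letter (V : nmodType) (F : option letter -> V) :
  \sum_s F s = F None + F (Some L) + F (Some R).
Proof.
rewrite (bigD1 None) // (bigD1 (Some L)) // (bigD1 (Some R)) //=.
by rewrite big1 ?addr0 ?addrA // => -[[]|].
Qed.

(** * The recurrence for path enumerators *)

Section Recurrence.
Variables (A : comNzRingType) (r : nat) (b : nat -> nat) (u : nat -> A).
Hypothesis shape : ferrers_shape r b.

(** A move is injective on cells, so only one cell feeds the target. For L this needs positive rows,
    since the predecessor identifies 0 and 1. *)
Lemma G_target j y a :
  in_ferrers r b y -> in_ferrers r b (target a y) ->
  G r b u j.+1 (target a y) (Some a)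
  = \sum_s G r b u j y s * move_weight u j.+1 s a.
Proof.
move=> yF tF; have yC : y \in ferrers_cells r b by rewrite mem_ferrers_cells.
rewrite /= (bigD1 (SeqSub yC)) //= [X in _ + X]big1 ?addr0 => [|z zy].
  apply: eq_bigr => s _; rewrite (big_pred1 a) // => a'.
  rewrite /= -[Some a == _]/(a == a') [a == a']eq_sym.
  by case: (a' =P a) => [->|_]; rewrite ?andbF // tF eqxx.
apply: big1 => s _; apply: big_pred0 => a'.
apply/negP => /andP[/andP[zF /eqP e] /eqP [aa]].
move/negP: zy; apply; apply/eqP/val_inj => /=; subst a'.
have : in_ferrers r b (ssval z) by rewrite -mem_ferrers_cells (valP z).
move: yF tF zF e; rewrite /in_ferrers.
case: (ssval z) y {yC} => [z1 z2] [y1 y2].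
by case: a => /= yF tF zF [e1 e2] zF'; congr (_, _); lia.
Qed.

Lemma G_notin j x a :
  (forall y, in_ferrers r b y -> target a y <> x) ->
  G r b u j.+1 x (Some a) = 0.
Proof.
move=> no; rewrite /= big1 // => y _; rewrite big1 // => s _.
apply: big_pred0 => a'; apply/negP => /andP[/andP[_ /eqP e] /eqP [aa]]; subst a'.
by apply: (no (val y)); rewrite -?mem_ferrers_cells ?(valP y).
Qed.

Lemma G_None j x : G r b u j.+1 x None = 0.
Proof.
rewrite /= big1 // => y _; rewrite big1 // => s _; apply: big_pred0 => a.
by rewrite andbF.
Qed.

(* The value 1 on the diagonal c = i - 1 just below the minimal cells makes the
   recurrence hold for c = i + 1 as well. *)
Definition cell_enum i c : A :=
  if (c < i)%N then 1 else \sum_s G r b u (c - i) (i, c) s.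

Lemma cell_enum_diag i : (1 <= i <= r)%N -> cell_enum i i = 1.
Proof.
move=> i_in; rewrite /cell_enum ltnn subnn big_option_letter /= /G0 /=.
by rewrite eqxx i_in !addr0.
Qed.

(** A final R carries weight 1, so deleting it preserves weights. *)
Lemma G_right i c : in_ferrers r b (i, c) -> (i < c)%N ->
  G r b u (c - i) (i, c) (Some R) = cell_enum i c.-1.
Proof.
move=> icF ic; have yF : in_ferrers r b (i, c.-1).
  by move: icF; rewrite /in_ferrers /=; lia.
have e : (i, c) = target R (i, c.-1) by rewrite /= prednK //; lia.
have -> : (c - i = (c.-1 - i).+1)%N by lia.
rewrite e G_target -?e // /cell_enum ifF; last by lia.
by apply: eq_bigr => s _; rewrite /= mulr1.
Qed.

(** A final L comes from (i+1, c) and costs u_k, k = c - i, unless the move before it was also L.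
    Hence the paths through (i+1, c) whose previous move is R, counted by the value at (i+1, c-1),
    are corrected by the factor u_k. *)
Lemma cell_enum_rec i c : in_ferrers r b (i, c) -> (i < c)%N ->
  cell_enum i c = cell_enum i c.-1 +
    (cell_enum i.+1 c - (1 - u (c - i)%N) * cell_enum i.+1 c.-1)
      *+ in_ferrers r b (i.+1, c).
Proof.
move=> icF ic; rewrite {1}/cell_enum ifF; last by lia.
rewrite big_option_letter G_right //.
have -> : G r b u (c - i) (i, c) None = 0.
  by have -> : (c - i = (c - i).-1.+1)%N by [lia]; rewrite G_None.
rewrite add0r addrC; congr (_ + _).
case: (boolP (in_ferrers r b (i.+1, c))) => yF; last first.
  have -> : (c - i = (c - i).-1.+1)%N by lia.
  rewrite mulr0n G_notin // => -[y1 y2] + [] e1 e2.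
  by move: icF yF; rewrite -e2 -e1 /in_ferrers /=; case: y1 {e1} => [|y1] /=; lia.
rewrite mulr1n.
have e : (i, c) = target L (i.+1, c) by [].
have -> : (c - i = (c - i.+1).+1)%N by lia.
rewrite {1}e G_target -?e // !big_option_letter /= expr1 expr0 mulr1.
rewrite {1}/cell_enum ifF; last by lia.
rewrite big_option_letter.
case: (ltngtP i.+1 c) ic => // [i1c _|<- _]; last first.
  (* Here (i+1, c) is minimal and its only path is empty; the conventional value 1 below the
     diagonal yields 1 - (1 - u) = u. *)
  rewrite subnn /= /G0 /= /cell_enum ltnSn !eqxx.
  have -> : (0 < i.+1 <= r)%N by case/andP: yF.
  by rewrite /=; ring.
have -> : G r b u (c - i.+1) (i.+1, c) None = 0.
  by have -> : (c - i.+1 = (c - i.+1).-1.+1)%N by [lia]; rewrite G_None.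
by rewrite G_right //; ring.
Qed.
End Recurrence.

(** * Products of power series with polynomials *)

(* The coefficient of t^n in (sum_m z_m t^m) * p(t): power series are
   represented by their coefficient sequences. *)
Definition series_mul (A : comNzRingType) (z : nat -> A) (p : {poly A})
    (n : nat) : A :=
  \sum_(k < n.+1) z (n - k)%N * p`_k.

Section SeriesMul.
Variable A : comNzRingType.
Implicit Types (z : nat -> A) (p q : {poly A}) (n : nat).

Lemma series_mul_poly z p n :
  series_mul z p n = (\poly_(m < n.+1) z m * p)`_n.
Proof.
rewrite coefMr; apply: eq_bigr => k _.
by rewrite coef_poly ltnS leq_subr.
Qed.

Lemma eq_series_mul z z' p : z =1 z' -> series_mul z p =1 series_mul z' p.
Proof. by move=> e n; apply: eq_bigr => k _; rewrite e. Qed.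

Lemma series_mulB z z' p n :
  series_mul (fun m => z m - z' m) p n = series_mul z p n - series_mul z' p n.
Proof. by rewrite -sumrB; apply: eq_bigr => k _; rewrite mulrBl. Qed.

Lemma series_mulD z z' p n :
  series_mul (fun m => z m + z' m) p n = series_mul z p n + series_mul z' p n.
Proof. by rewrite -big_split; apply: eq_bigr => k _; rewrite mulrDl. Qed.

(** The hypotheses say that (1 - a t) z(t) = z'(t). *)
Lemma series_mul_geom a z z' p :
  z 0%N = z' 0%N -> (forall m, z m.+1 = z' m.+1 + a * z m) ->
  series_mul z (p * (1 - a%:P * 'X)) =1 series_mul z' p.
Proof.
move=> e0 eS n; rewrite !series_mul_poly mulrCA [p * _]mulrC !coefMr.
apply: eq_bigr => k _; congr (_ * _).
have kn : (n - k <= n)%N by rewrite leq_subr.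
rewrite mulrBr mulr1 mulrCA coefB coefCM coefMX !coef_poly.
case: (n - k)%N kn => [|m] mn /=; first by rewrite mulr0 subr0 e0.
by rewrite !ifT; [rewrite eS addrK | lia ..].
Qed.

Lemma series_mulM1 a z p n :
  series_mul z (p * (1 - a%:P * 'X)) n
  = series_mul z p n - (if n is m.+1 then a * series_mul z p m else 0).
Proof.
rewrite /series_mul; under eq_bigr => k _.
  rewrite mulrBr mulr1 mulrCA coefB coefCM coefMX mulrBr mulrCA; over.
rewrite big_split /= sumrN; congr (_ - _).
rewrite -mulr_sumr big_ord_recl /= mulr0 add0r.
by case: n => [|n]; rewrite ?big_ord0 ?mulr0.
Qed.

(** Used to add a missing factor when a series has a shorter denominator than its neighbours. *)
Lemma series_mul_coefM1 a z p q :
  series_mul z p =1 (fun n => q`_n) ->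
  series_mul z (p * (1 - a%:P * 'X)) =1 (fun n => (q * (1 - a%:P * 'X))`_n).
Proof.
move=> e n; rewrite series_mulM1 e mulrBr mulr1 mulrCA coefB coefCM coefMX.
by case: n => [|n] /=; rewrite ?mulr0 ?e.
Qed.

Lemma series_mul_unit z p :
  z 0%N = 1 -> (forall m, z m.+1 = 0) -> series_mul z p =1 (fun n => p`_n).
Proof.
move=> z0 zS n; rewrite /series_mul big_ord_recr /= subnn z0 mul1r.
by rewrite big1 ?add0r // => k _; rewrite /= -subnSK // zS mul0r.
Qed.

End SeriesMul.

(** * Multichains of cells and the q-Zeta numerator *)

Section Multichains.
Variables (r : nat) (b : nat -> nat).
Hypothesis shape : ferrers_shape r b.
Local Notation F := (ferrers r b).

Lemma ferrers_pred i j : (1 <= i <= j)%N -> (j <= r)%N -> (b j <= b i)%N.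
Proof.
have [_ b_dec _] := shape.
move=> /andP[i1]; elim: j => [|j IH]; first by lia.
rewrite leq_eqVlt => /predU1P[->//|ij] jr.
by apply: leq_trans (b_dec j _) (IH _ _); lia.
Qed.

Definition below (x : nat * nat) (z : F) : bool :=
  (x.1 <= (val z).1)%N && ((val z).2 <= x.2)%N.

(* Multichains are built from the top element down; x need not be a cell. *)
Fixpoint chains_below (m : nat) (x : nat * nat) : {poly int} :=
  if m is m'.+1 then
    \sum_(z : F | below x z) 'X^(ferrers_rank z) * chains_below m' (val z)
  else 1.

(** A cell (z1, c+1) with z1 >= i would give i <= z1 <= c+1 <= b_z1 <= b_i, making (i, c+1) a
    cell. *)
Lemma big_below_notin (V : nmodType) (f : F -> V) i c :
  (0 < i)%N -> ~~ in_ferrers r b (i, c.+1) ->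
  \sum_(z | below (i, c.+1) z) f z = \sum_(z | below (i, c) z) f z.
Proof.
move=> i0 nF; apply: eq_bigl => z.
have := valP z; rewrite mem_ferrers_cells /below /in_ferrers /=.
case: (ssval z) => z1 z2 /= zF; case: (leqP i z1) => //= iz.
apply/idP/idP; last exact: leqW.
rewrite leq_eqVlt => /predU1P[ez|//].
have : (b z1 <= b i)%N by apply: ferrers_pred; lia.
by move: nF; rewrite /in_ferrers /=; lia.
Qed.

(** The cells below (i, c+1) other than itself lie below (i, c) or (i+1, c+1), and those below both
    are the ones below (i+1, c). *)
Lemma big_below_rec (V : zmodType) (f : F -> V) (y : F) i c :
  val y = (i, c.+1) ->
  \sum_(z | below (i, c.+1) z) f z =
  \sum_(z | below (i, c) z) f z + \sum_(z | below (i.+1, c.+1) z) f z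
  - \sum_(z | below (i.+1, c) z) f z + f y.
Proof.
move=> ey; have -> : f y = \sum_(z | z == y) f z by rewrite big_pred1_eq.
rewrite [LHS]big_mkcond [X in _ = X + _ - _ + _]big_mkcond.
rewrite [X in _ = _ + X - _ + _]big_mkcond [X in _ = _ + _ - X + _]big_mkcond.
rewrite [X in _ = _ + X]big_mkcond -big_split /= -sumrN -!big_split /=.
apply: eq_bigr => z _; rewrite -val_eqE ey /below /=.
case: (ssval z) => z1 z2; rewrite xpair_eqE /=.
have -> : (z2 <= c)%N = (z2 != c.+1) && (z2 <= c.+1)%N by lia.
case: (ltngtP i z1) => _ /=; case: (z2 =P c.+1) => [e|_]; rewrite ?e ?leqnn /=.
all: try case: (z2 <= c.+1)%N.
all: by rewrite ?subrr ?addrK ?subr0 ?add0r ?addr0 ?subrr.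
Qed.

Lemma chains_below_rec m (y : F) i c : val y = (i, c.+1) ->
  chains_below m.+1 (i, c.+1) =
  chains_below m.+1 (i, c) + chains_below m.+1 (i.+1, c.+1)
  - chains_below m.+1 (i.+1, c) + 'X^(c.+1 - i) * chains_below m (i, c.+1).
Proof. by move=> ey; rewrite [LHS](big_below_rec _ ey) /ferrers_rank ey. Qed.

(** Appending [y] as an extra top turns the upper bound into sortedness, and removing the largest
    entry of [x] matches one unfolding of [chains_below]. *)
Lemma multichain_below m (y : F) :
  chains_below m (val y) =
  \sum_(x : m.-tuple F | sorted <=%O (rcons x y))
    'X^(\sum_(z <- x) ferrers_rank z).
Proof.
elim: m y => [|m IH] y.
  rewrite (big_pred1 [tuple]) ?big_nil ?expr0 // => x.
  by rewrite [x]tuple0 /= eqxx.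
rewrite /= big_mkcond [RHS]big_mkcond /=.
rewrite (big_tuple_rcons _ (fun x : seq F => if sorted <=%O (rcons x y)
  then 'X^(\sum_(z <- x) ferrers_rank z) else 0)) exchange_big /=.
apply: eq_bigr => z _.
have E (x : seq F) : sorted <=%O (rcons (rcons x z) y)
               = sorted <=%O (rcons x z) && below (val y) z.
  by case: x => [|x0 x] /=; rewrite ?andbT // !rcons_path last_rcons.
under [RHS]eq_bigr do rewrite E big_rcons /=.
case: (below _ _); last by rewrite big1 // => x _; rewrite andbF.
rewrite IH mulr_sumr big_mkcond /=; apply: eq_bigr => x _; rewrite andbT.
by case: ifP => // _; rewrite exprD mulrC.
Qed.

Lemma ferrers_top : in_ferrers r b (1%N, b 1%N).
Proof.
have [r_gt0 _ b_ge] := shape.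
by rewrite /in_ferrers /= r_gt0 leqnn b_ge ?r_gt0.
Qed.

Lemma ferrers_le_top (z : F) : (1 <= (val z).1)%N && ((val z).2 <= b 1%N)%N.
Proof.
have := valP z; rewrite mem_ferrers_cells /in_ferrers /=.
case: (ssval z) => z1 z2 /= z_in.
have : (b z1 <= b 1)%N by apply: ferrers_pred; lia.
by lia.
Qed.

Lemma max_ferrers_rank : max_rank (@ferrers_rank r b) = wlen b.
Proof.
have topC : (1%N, b 1%N) \in ferrers_cells r b.
  by rewrite mem_ferrers_cells ferrers_top.
apply/eqP; rewrite eqn_leq; apply/andP; split.
  apply/bigmax_leqP => z _; rewrite /ferrers_rank /wlen.
  by have := ferrers_le_top z; case: (val z) => z1 z2 /=; lia.
rewrite /wlen -subn1 -[(b 1%N - 1)%N]/(ferrers_rank (SeqSub topC : F)).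
exact: leq_bigmax.
Qed.

Lemma multichain_enum_below m :
  multichain_enum (@ferrers_rank r b) m = chains_below m (1%N, b 1%N).
Proof.
have topC : (1%N, b 1%N) \in ferrers_cells r b.
  by rewrite mem_ferrers_cells ferrers_top.
rewrite -[(1%N, b 1%N)]/(val (SeqSub topC : F)) multichain_below.
apply: eq_bigl => x; case: (val x) => //= x0 s; rewrite rcons_path.
by rewrite [(_ <= _)%O]ferrers_le_top andbT.
Qed.

Definition geom_den (k : nat) : {poly {poly int}} :=
  \prod_(a < k) (1 - ('X^a)%:P * 'X).

(** Strong induction on k = c - i + 1, the number of factors. At k = 0 the pair (i, i-1) is no cell
    and nothing lies below it, so both sides are 1. *)
Lemma series_mul_chains_below k i c :
  (0 < i)%N -> (c.+1 = i + k)%N -> ((0 < k)%N -> in_ferrers r b (i, c)) ->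
  series_mul (chains_below^~ (i, c)) (geom_den k)
  =1 (fun n => (cell_enum r b tq_weight i c)`_n).
Proof.
have [k0] := ubnP k; elim: k0 k i c => // k0 IH [|k] i c kk0 i_gt0 ck icF n.
  have -> : cell_enum r b tq_weight i c = geom_den 0.
    by rewrite /geom_den big_ord0 /cell_enum ifT //; lia.
  apply: series_mul_unit => // m; rewrite /= big_pred0 // => z.
  have := valP z; rewrite mem_ferrers_cells /in_ferrers /below /=.
  case: (ssval z) => z1 z2 /= zF; lia.
have {}icF := icF isT; case: c => [|c] in ck icF *; first by lia.
have icC : (i, c.+1) \in ferrers_cells r b by rewrite mem_ferrers_cells.
have rec m := @chains_below_rec m (SeqSub icC) _ _ erefl.
have ci : (c.+1 - i = k)%N by lia.
have lower n' := IH k i c ltac:(lia) i_gt0 ltac:(lia)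
  ltac:(by move: icF; rewrite /in_ferrers /=; lia) n'.
rewrite /geom_den big_ord_recr /= -/(geom_den k).
have [y_in|y_notin] := boolP (in_ferrers r b (i.+1, c.+1)); last first.
  rewrite (series_mul_geom (z' := chains_below^~ (i, c))) // => [|m].
    rewrite lower; move: (icF); rewrite /in_ferrers /= => /andP[i_in /andP[]].
    (* For a minimal cell (i, i), both its enumerator and the conventional one just below it are
       1. *)
    rewrite leq_eqVlt => /predU1P[ei|ic] _.
      by rewrite -ei cell_enum_diag // /cell_enum ei ltnSn.
    by rewrite [in RHS]cell_enum_rec // (negPf y_notin) mulr0n addr0.
  by rewrite rec ci [X in _ + X - _]/= big_below_notin // addrK.
rewrite (series_mul_geom (z' := fun m => chains_below m (i, c)
   + chains_below m (i.+1, c.+1) - chains_below m (i.+1, c))) => [||m]; last 2 first.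
(* Constant terms: 1 = 1 + 1 - 1. *)
- by rewrite /= addrK.
- by rewrite rec ci.
rewrite series_mulB series_mulD lower IH //; try lia.
have k_gt0 : (0 < k)%N by move: y_in; rewrite /in_ferrers /=; lia.
(* The pair (i+1, c) has rank one lower than the other two. Its missing factor 1 - q^(k-1) t is
   exactly 1 - u_k. *)
rewrite -(prednK k_gt0) /geom_den big_ord_recr /= -/(geom_den k.-1).
rewrite (series_mul_coefM1 _ (IH k.-1 i.+1 c _ _ _ _)); try lia; last first.
  by move: icF y_in; rewrite /in_ferrers /=; lia.
rewrite [in RHS]cell_enum_rec //; last by lia.
rewrite y_in mulr1n !coefD coefN ci /tq_weight /= ['X * _]mulrC addrA.
by rewrite [cell_enum _ _ _ i.+1 c * _]mulrC.
Qed.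

(** At the top cell (1, b_1), the M + 1 factors of [geom_den] are those of [qzeta_den], since the
    maximal rank is M. *)
Lemma is_qzeta_numerator_descent N :
  is_qzeta_numerator (@ferrers_rank r b) N <-> N = descent_enum r b tq_weight.
Proof.
have b1 : (1 <= b 1)%N by case/andP: ferrers_top => _ /andP[].
have main n : series_mul (multichain_enum (@ferrers_rank r b))
    (qzeta_den (@ferrers_rank r b)) n = (descent_enum r b tq_weight)`_n.
  rewrite /qzeta_den max_ferrers_rank (eq_series_mul _ multichain_enum_below).
  rewrite series_mul_chains_below ?ferrers_top // /wlen ?prednK //.
  rewrite descent_enum_G // /cell_enum ltnNge b1 /=.
  by rewrite /wlen subn1.
split=> [numN|-> n]; last exact: main.
by apply/polyP => n; rewrite -main -numN.
Qed.

End Multichains.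

Lemma subst_tq_descent r b :
  subst_tq (descent_poly r b) = descent_enum r b tq_weight.
Proof.
rewrite /subst_tq /descent_poly /descent_enum rmorph_sum.
apply: eq_bigr => w _ /=.
rewrite rmorph_prod big_seq_cond [RHS]big_seq_cond.
apply: eq_bigr => j /andP[+ _] /=.
rewrite mem_iota /indet => /andP[j_gt0 j_le].
case: insubP => [k _ ek|]; last by rewrite -leqNgt; lia.
by rewrite mmapX mmap1U ek prednK.
Qed.

(** * The table-filling program and its cost *)

Section Program.
Variables (r : nat) (b : nat -> nat).

Definition level_moves (j : nat) : seq transition :=
  [seq T <- [seq Transition j (val p.1.1) p.1.2 p.2 |
              p <- enum {: ferrers r b * option letter * letter}]
   | in_ferrers r b (target (tr_move T) (tr_cell T))].

Definition all_moves (m : nat) : seq transition :=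
  flatten [seq level_moves j | j <- iota 1 m].

Lemma all_movesS m : all_moves m.+1 = all_moves m ++ level_moves m.+1.
Proof.
by rewrite /all_moves -[m.+1]addn1 iotaD map_cat flatten_cat /= cats0 add1n addn1.
Qed.

Lemma all_moves_legal : all (legal_transition r b) (all_moves (wlen b)).
Proof.
rewrite /all_moves; have := leqnn (wlen b); move: {1 3}(wlen b) => m.
elim: m => // m IH m_le.
rewrite -/(all_moves _) all_movesS all_cat IH ?(ltnW m_le) //=.
rewrite all_filter all_map; apply/allP => p _ /=; apply/implyP => tF.
by rewrite /legal_transition /= m_le tF -mem_ferrers_cells (valP p.1.1).
Qed.

(** Each level uses at most 3 previous moves times 2 letters per cell. *)
Lemma size_all_moves m : (size (all_moves m) <= 6 * (m * #|{: ferrers r b}|))%N.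
Proof.
elim: m => // m IH; rewrite all_movesS size_cat [(m.+1 * _)%N]mulSn mulnDr addnC.
apply: leq_add => [|//]; rewrite size_filter (leq_trans (count_size _ _)) //.
rewrite size_map -cardE !card_prod card_option.
have -> : #|{: letter}| = 2%N.
  by rewrite -card_bool; apply: bij_eq_card (Bijective isLK _) => -[].
by rewrite -mulnA mulnC.
Qed.

Variables (A : comNzRingType) (u : nat -> A).

(** Updates of level j read only level j-1, which they leave unchanged, so their contributions
    simply add up. *)
Lemma foldl_exec j prog (g : table A) : (0 < j)%N ->
  all (fun T => tr_level T == j) prog ->
  forall j' x s, foldl (exec u) g prog j' x s = g j' x s +
    (\sum_(T <- prog | (x == target (tr_move T) (tr_cell T))
                       && (s == Some (tr_move T)))
       g j.-1 (tr_cell T) (tr_prev T) * move_weight u j (tr_prev T) (tr_move T))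
    *+ (j' == j).
Proof.
move=> j_gt0; elim: prog g => [|T prog IH] g /=.
  by move=> _ j' x s; rewrite big_nil mul0rn addr0.
case/andP=> /eqP Tj progj j' x s; rewrite IH // big_cons.
have below_j y s' : exec u g T j.-1 y s' = g j.-1 y s'.
  by rewrite /exec Tj ifN // negb_and; apply/orP; left; lia.
under [X in _ + X *+ _ = _]eq_bigr => T' _ do rewrite below_j.
rewrite /exec Tj.
case: (eqVneq j' j) => [->|_] /=; last by rewrite mulr0n.
by case: ifP => // _; rewrite !mulr1n addrA.
Qed.

Lemma run_all_moves m j x s :
  run r u (all_moves m) j x s = if (j <= m)%N then G r b u j x s else 0.
Proof.
elim: m j x s => [|m IH] j x s.
  by rewrite /run /= /init_table leqn0; case: eqP => [->|].
rewrite /run all_movesS foldl_cat (@foldl_exec m.+1) //; last first.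
  by rewrite all_filter all_map; apply/allP => p _ /=; rewrite eqxx implybT.
rewrite -/(run r u _) IH; case: (ltngtP j m.+1) => [jm|jm|->].
- by rewrite -ltnS jm addr0.
- by rewrite ifN ?addr0 // -ltnNge ltnW.
rewrite ltnn add0r mulr1n big_filter_cond big_map big_enum_cond big_mkcond /=.
under [RHS]eq_bigr => y _ do under eq_bigr => s' _ do rewrite big_mkcond.
rewrite pair_bigA pair_bigA /=; apply: eq_bigr => -[[y s'] a] _ /=.
by rewrite IH leqnn andbA.
Qed.

Lemma output_all_moves : ferrers_shape r b ->
  output b (run r u (all_moves (wlen b))) = descent_enum r b u.
Proof.
move=> shape; rewrite descent_enum_G //; apply: eq_bigr => s _.
by rewrite run_all_moves leqnn.
Qed.

End Program.

Theorem proposition5p3 :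
  [/\ forall (r : nat) (b : nat -> nat), ferrers_shape r b ->
        descent_poly r b
        = \sum_(s : option letter)
            G r b (indet (wlen b)) (wlen b) (1%N, b 1%N) s,
      forall (r : nat) (b : nat -> nat), ferrers_shape r b ->
        forall N : {poly {poly int}},
          is_qzeta_numerator (@ferrers_rank r b) N
          <-> N = subst_tq (descent_poly r b)
    & exists C : nat, forall (r : nat) (b : nat -> nat), ferrers_shape r b ->
        exists prog : seq transition,
          [/\ all (legal_transition r b) prog,
              (size prog <= C * (wlen b * #|{: ferrers r b}|))%N,
              output b (run r (indet (wlen b)) prog) = descent_poly r b
            & is_qzeta_numerator (@ferrers_rank r b)
                (output b (run r tq_weight prog))]].
Proof.
split=> [r b shape|r b shape N|]; first exact: descent_enum_G.
  by rewrite subst_tq_descent; exact: is_qzeta_numerator_descent.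
(* The same program is run over both rings, with the indeterminates and with the weights t
   q^(j-1). *)
exists 6%N => r b shape; exists (all_moves r b (wlen b)); split.
- exact: all_moves_legal.
- exact: size_all_moves.
- exact: output_all_moves.
- by apply/is_qzeta_numerator_descent => //; exact: output_all_moves.
Qed.
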